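(* Consider the linear Gaussian policy-augmented knowledge graph (pKG) model and the permutation-sampling estimator of the variance-based Shapley values of the policy parameters described in the context, with state dimension $n$, action dimension $m$, horizon $H$, $Q$ sampled sets of model parameters and $D$ sampled permutations per set. The cost to compute the approximate variance-based Shapley values of all policy parameters with value function $g(\mathcal U\mid\pmb w)=\mathrm{Var}[Y\mid\pmb\theta_{\mathcal O\setminus\mathcal U}=0;\pmb w]$, where $Y=\sum_{t=0}^{H-1}r_{t+1}$ is the cumulative reward, using the recursive variance calculation described in the context, is $O\left(QDH^3(n^4m+n^3m^2)\right)$. For the brute force algorithm without reusing calculations, described in the context, the cost is $O\left(QDH^6(n^4m+n^3m^2)\right)$.
   Context: Linear Gaussian pKG model. States $\pmb s_t\in\mathbb{R}^n$, actions $\pmb a_t\in\mathbb{R}^m$, $t=1,\dots,H$; $\pmb s_1=\pmb s_0+\pmb e_1$ with $\pmb s_0$ fixed; $\pmb s_{t+1}=\pmb\mu^s_{t+1}+(\pmb\beta^s_t)^\top(\pmb s_t-\pmb\mu^s_t)+(\pmb\beta^a_t)^\top(\pmb a_t-\pmb\mu^a_t)+\pmb e_{t+1}$ with $\pmb\beta^s_t\in\mathbb{R}^{n\times n}$, $\pmb\beta^a_t\in\mathbb{R}^{m\times n}$ and $\pmb e=(\pmb e_1,\dots,\pmb e_H)$ a Gaussian vector; linear policy $\pmb a_t=\pmb\mu^a_t+\pmb\theta_t^\top(\pmb s_t-\pmb\mu^s_t)$ with $\pmb\theta_t\in\mathbb{R}^{n\times m}$; reward $r_t=m_t+\pmb b_t^\top\pmb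 a_t+\pmb c_t^\top\pmb s_t$. Model parameters $\pmb w$ are the entries of $\pmb\beta^s_t,\pmb\beta^a_t$ and the covariance of $\pmb e$. For $i\le t$ let $\mathbf R_{i,t}=M_tM_{t-1}\cdots M_i$ with $M_j=(\pmb\beta^s_j)^\top+(\pmb\beta^a_j)^\top\pmb\theta_j^\top$, and $\pmb\alpha_{t}=\pmb b_t^\top\pmb\theta_t^\top+\pmb c_t^\top$. Inputs: $\mathcal O$ is the set of all scalar policy parameters $\theta_t^{ij}$ ($1\le i\le n,1\le j\le m,1\le t\le H$), so $|\mathcal O|=Hnm$. The value function sets all policy parameters not in $\mathcal U$ to zero. At a given (modified) $\pmb\theta$, $$\mathrm{Var}\Big[\sum_{t=0}^{H-1}r_{t+1}\Big]=\sum_{t_1=0}^{H-1}\sum_{t_2=0}^{H-1}\pmb\alpha_{t_1+1}\mathrm{Cov}(\pmb s_{t_1+1},\pmb s_{t_2+1})\pmb\alpha_{t_2+1}^\top .$$ Recursive variance calculation: $\mathrm{Cov}(\pmb s_{t_1+1},\pmb s_{t_2+1})=\mathbf A^1_{t_1+1,t_2+1}+\mathbf A^2_{t_1+1,t_2+1}+\mathbf A^3_{t_1+1,t_2+1}+\mathrm{Cov}(\pmb e_{t_1+1},\pmb e_{t_2+1})$, where $\mathbf A^1_{t_1+1,t_2+1}=\sum_{i=1}^{t_1}\sum_{j=1}^{t_2}\mathbf R_{i,t_1}\mathrm{Cov}(\pmb e_i,\pmb e_j)\mathbf R_{j,t_2}^\top$, $\mathbf A^2_{t_1+1,t_2+1}=\sum_{i=1}^{t_1}\mathbf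 R_{i,t_1}\mathrm{Cov}(\pmb e_i,\pmb e_{t_2+1})$, $\mathbf A^3_{t_1+1,t_2+1}=\sum_{i=1}^{t_2}\mathrm{Cov}(\pmb e_{t_1+1},\pmb e_i)\mathbf R_{i,t_2}^\top$ are computed and stored for all pairs by the recursions $$\mathbf A^1_{t_1+1,t_2+1}=(\mathbf A^1_{t_1+1,t_2}+\mathbf A^2_{t_1+1,t_2})\mathbf R_{t_2,t_2}^\top,\quad \mathbf A^2_{t_1+1,t_2+1}=\mathbf R_{t_1,t_1}(\mathbf A^2_{t_1,t_2+1}+\mathrm{Cov}(\pmb e_{t_1},\pmb e_{t_2+1})),\quad \mathbf A^3_{t_1+1,t_2+1}=(\mathbf A^3_{t_1+1,t_2}+\mathrm{Cov}(\pmb e_{t_1+1},\pmb e_{t_2}))\mathbf R_{t_2,t_2}^\top$$ (with empty sums equal to zero as initial values: $\mathbf A^1$ is zero if $t_1=0$ or $t_2=0$, $\mathbf A^2$ is zero if $t_1=0$, $\mathbf A^3$ is zero if $t_2=0$); then the double sum above is accumulated. Brute force algorithm: for each pair $(t_1,t_2)$, each term of the sums defining $\mathbf A^1,\mathbf A^2,\mathbf A^3$ is computed directly, with every $\mathbf R_{i,t}$ recomputed from its definition as a matrix product each time it occurs; then the double sum is accumulated. Estimator: for sampled model parameters $\pmb w^{(q)}$, $q=1,\dots,Q$, and for each $q$ sampled permutations $\pi^{(d)}$ of $\mathcal O$, $d=1,\dots,D$, one computes $$\widehat{\mathrm{Sh}}(Y\mid o)=\frac1{QD}\sum_{q=1}^Q\sum_{d=1}^D\left[g(P_o(\pi^{(d)})\cup\{o\}\mid\pmb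 w^{(q)})-g(P_o(\pi^{(d)})\mid\pmb w^{(q)})\right]$$ for all $o\in\mathcal O$, where $P_o(\pi)$ is the set of inputs preceding $o$ in $\pi$. For each $(q,d)$ the value function is evaluated once on each of the $|\mathcal O|+1$ initial segments of $\pi^{(d)}$, independently of the evaluations on the other segments. Cost model: number of arithmetic operations, with the samples and the matrices $\mathrm{Cov}(\pmb e_i,\pmb e_j)$ given; multiplying a $p\times q$ matrix by a $q\times r$ matrix in the naive way costs $O(pqr)$. *)

(* Defs.v *)
(* MathComp / MathComp-Analysis *)
From HB Require Import structures.
From mathcomp Require Import all_boot all_order all_algebra.
From mathcomp Require Import all_classical all_reals all_analysis.

Set Implicit Arguments.
Unset Strict Implicit.
Unset Printing Implicit Defensive.

Import Order.TTheory GRing.Theory Num.Theory.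
Local Open Scope ring_scope.

(* Times are 1-based natural numbers, as in s_1, ..., s_H.  Families indexed by
   time are functions on nat of which only the values at times 1, ..., H are
   meaningful. *)

(** * The linear Gaussian model *)

Record model (R : realType) (n m : nat) := Model {
  init_state : 'cV[R]_n;               (* s_0 *)
  mu_s : nat -> 'cV[R]_n;
  mu_a : nat -> 'cV[R]_m;
  rew_cst : nat -> R;                  (* m_t *)
  rew_a : nat -> 'cV[R]_m;             (* b_t *)
  rew_s : nat -> 'cV[R]_n              (* c_t *)
}.

(* The sampled parameters w; [noise_cov w i j] is Cov(e_i, e_j). *)
Record params (R : realType) (n m : nat) := Params {
  beta_s : nat -> 'M[R]_n;
  beta_a : nat -> 'M[R]_(m, n);
  noise_cov : nat -> nat -> 'M[R]_n
}.

Definition policy (R : realType) (n m : nat) := nat -> 'M[R]_(n, m).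

Definition action (R : realType) (n m : nat) (K : model R n m)
    (th : policy R n m) (t : nat) (s : 'cV[R]_n) : 'cV[R]_m :=
  mu_a K t + (th t)^T *m (s - mu_s K t).

Fixpoint state (R : realType) (n m : nat) (K : model R n m) (w : params R n m)
    (th : policy R n m) (e : nat -> 'cV[R]_n) (t : nat) : 'cV[R]_n :=
  match t with
  | 0%N => init_state K
  | t'.+1 =>
    (if t' == 0%N then init_state K
     else let s := state K w th e t' in
       mu_s K t'.+1 + (beta_s w t')^T *m (s - mu_s K t')
       + (beta_a w t')^T *m (action K th t' s - mu_a K t'))
    + e t'.+1
  end.

Definition reward (R : realType) (n m : nat) (K : model R n m)
    (w : params R n m) (th : policy R n m) (e : nat -> 'cV[R]_n) (t : nat) : R :=
  let s := state K w th e t in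
  rew_cst K t + ((rew_a K t)^T *m action K th t s) 0 0
  + ((rew_s K t)^T *m s) 0 0.

Definition cumulative_reward (R : realType) (n m : nat) (H : nat)
    (K : model R n m) (w : params R n m) (th : policy R n m)
    (e : nat -> 'cV[R]_n) : R :=
  \sum_(0 <= t < H) reward K w th e t.+1.

(** * The noise *)

(* The degenerate case sigma = 0 is the point mass: the library's [normal_prob]
   has an unrelated value there. *)
Definition gaussian (d : measure_display) (T : measurableType d) (R : realType)
    (P : probability T R) (X : T -> R) : Prop :=
  measurable_fun setT X /\
  exists mu sigma : R, 0 <= sigma /\
    forall A : set R, measurable A ->
      pushforward P X A =
        if sigma == 0 then dirac mu A else normal_prob mu sigma A.

Definition gaussian_vector (d : measure_display) (T : measurableType d)
    (R : realType) (P : probability T R) (I : finType) (X : I -> T -> R) : Prop :=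
  forall a : I -> R, gaussian P (fun x => \sum_i a i * X i x).

(* (e_1, ..., e_H) is Gaussian with the covariance prescribed by w; [e t i] is
   the i-th coordinate of e_t.  The mean is arbitrary. *)
Definition noise_model (d : measure_display) (T : measurableType d)
    (R : realType) (n m H : nat) (P : probability T R)
    (e : nat -> 'I_n -> T -> R) (w : params R n m) : Prop :=
  gaussian_vector P (fun ki : 'I_H * 'I_n => e ki.1.+1 ki.2) /\
  forall (k l : 'I_H) (i j : 'I_n),
    covariance P (e k.+1 i) (e l.+1 j) = (noise_cov w k.+1 l.+1 i j)%:E.

(** * Inputs, value function and estimator *)

(* The input (k, i, j) is the scalar policy parameter theta_{k+1}^{ij}. *)
Definition inputs (H n m : nat) : finType := ('I_H * 'I_n * 'I_m)%type.

Definition restrict (R : realType) (H n m : nat) (th : policy R n m)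
    (U : {set inputs H n m}) : policy R n m :=
  fun t => \matrix_(i < n, j < m)
    if [exists k : 'I_H, (k.+1 == t) && ((k, i, j) \in U)] then th t i j else 0.

Definition value (d : measure_display) (T : measurableType d) (R : realType)
    (n m H : nat) (K : model R n m) (th : policy R n m) (P : probability T R)
    (e : nat -> 'I_n -> T -> R) (w : params R n m)
    (U : {set inputs H n m}) : \bar R :=
  variance P (fun x =>
    cumulative_reward H K w (restrict th U) (fun t => \col_i e t i x)).

(* A permutation of a finite type is given by the list of its elements in the
   corresponding order. *)
Definition preceding (O : finType) (pi : seq O) (o : O) : {set O} :=
  [set x in take (index o pi) pi].

Definition shapley_hat (R : realType) (O : finType) (Q D : nat)
    (g : 'I_Q -> {set O} -> \bar R) (pi : 'I_Q -> 'I_D -> seq O) (o : O) : \bar R :=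
  (((Q * D)%:R^-1)%:E *
   \sum_(q < Q) \sum_(d < D)
     (g q (o |: preceding (pi q d) o) - g q (preceding (pi q d) o)))%E.

(** * Computations with a count of scalar arithmetic operations *)

(* Below, scalars are combined only through [cadd], [csub], [cmul] and [cdiv];
   reading, storing, transposing and replacing entries by zero are free. *)
Record counted (A : Type) := Counted { result : A; ops : nat }.

Definition cret (A : Type) (x : A) : counted A := Counted x 0.

Definition cbind (A B : Type) (c : counted A) (f : A -> counted B) : counted B :=
  Counted (result (f (result c))) (ops c + ops (f (result c))).

Notation "'let*' x ':=' c 'in' k" := (cbind c (fun x => k))
  (at level 200, x name, right associativity).

Definition cadd (R : realType) (x y : R) : counted R := Counted (x + y) 1.
Definition csub (R : realType) (x y : R) : counted R := Counted (x - y) 1.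
Definition cmul (R : realType) (x y : R) : counted R := Counted (x * y) 1.
Definition cdiv (R : realType) (x y : R) : counted R := Counted (x / y) 1.

Definition cfold (A I : Type) (f : A -> I -> counted A) (s : seq I) (x : A) :
    counted A :=
  foldl (fun c i => let* y := c in f y i) (cret x) s.

(* Entries are computed one after the other, nothing being shared. *)
Definition ctable (A : Type) (I : finType) (F : I -> counted A) :
    counted {ffun I -> A} :=
  Counted [ffun i => result (F i)] (\sum_i ops (F i))%N.

Definition cmatrix (R : realType) (p q : nat) (F : 'I_p -> 'I_q -> counted R) :
    counted 'M[R]_(p, q) :=
  Counted (\matrix_(i, j) result (F i j)) (\sum_i \sum_j ops (F i j))%N.

Definition csum (R : realType) (I : Type) (s : seq I) (F : I -> counted R) :
    counted R :=
  cfold (fun acc i => let* x := F i in cadd acc x) s 0.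

Definition caddmx (R : realType) (p q : nat) (A B : 'M[R]_(p, q)) :
    counted 'M[R]_(p, q) :=
  cmatrix (fun i j => cadd (A i j) (B i j)).

Definition cmulmx (R : realType) (p q r : nat) (A : 'M[R]_(p, q))
    (B : 'M[R]_(q, r)) : counted 'M[R]_(p, r) :=
  cmatrix (fun i k => csum (enum 'I_q) (fun j => cmul (A i j) (B j k))).

Definition csummx (R : realType) (p q : nat) (I : Type) (s : seq I)
    (F : I -> counted 'M[R]_(p, q)) : counted 'M[R]_(p, q) :=
  cfold (fun acc i => let* X := F i in caddmx acc X) s 0.

(** * The two variance computations *)

(* M_t = R_{t,t} *)
Definition cstep (R : realType) (n m : nat) (w : params R n m)
    (th : policy R n m) (t : nat) : counted 'M[R]_n :=
  let* X := cmulmx (beta_a w t)^T (th t)^T in caddmx (beta_s w t)^T X.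

(* alpha_t *)
Definition calpha (R : realType) (n m : nat) (K : model R n m)
    (th : policy R n m) (t : nat) : counted 'rV[R]_n :=
  let* x := cmulmx (rew_a K t)^T (th t)^T in caddmx x (rew_s K t)^T.

(* alpha_{t1} S alpha_{t2}^T *)
Definition cquad (R : realType) (n m : nat) (K : model R n m)
    (th : policy R n m) (t1 t2 : nat) (S : 'M[R]_n) : counted R :=
  let* a1 := calpha K th t1 in
  let* a2 := calpha K th t2 in
  let* x := cmulmx a1 S in
  let* y := cmulmx x a2^T in
  cret (y 0 0).

Definition ccov (R : realType) (n : nat) (A1 A2 A3 S : 'M[R]_n) :
    counted 'M[R]_n :=
  let* X := caddmx A1 A2 in let* Y := caddmx X A3 in caddmx Y S.

Definition time_pairs (H : nat) : seq (nat * nat) :=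
  [seq (t1, t2) | t1 <- iota 0 H, t2 <- iota 0 H].

Definition store (A : Type) (X : nat -> nat -> A) (i j : nat) (x : A) :
    nat -> nat -> A :=
  fun i' j' => if (i' == i) && (j' == j) then x else X i' j'.

Record tables (R : realType) (n : nat) := Tables {
  tab1 : nat -> nat -> 'M[R]_n;
  tab2 : nat -> nat -> 'M[R]_n;
  tab3 : nat -> nat -> 'M[R]_n
}.

(* Computes and stores the entries of index (t1 + 1, t2 + 1). *)
Definition recursive_step (R : realType) (n m : nat) (w : params R n m)
    (th : policy R n m) (T : tables R n) (t : nat * nat) : counted (tables R n) :=
  let t1 := t.1 in let t2 := t.2 in
  let* X1 := if (t1 == 0%N) || (t2 == 0%N) then cret 0
             else let* X := caddmx (tab1 T t1.+1 t2) (tab2 T t1.+1 t2) in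
                  let* M := cstep w th t2 in
                  cmulmx X M^T in
  let* X2 := if t1 == 0%N then cret 0
             else let* M := cstep w th t1 in
                  let* X := caddmx (tab2 T t1 t2.+1) (noise_cov w t1 t2.+1) in
                  cmulmx M X in
  let* X3 := if t2 == 0%N then cret 0
             else let* X := caddmx (tab3 T t1.+1 t2) (noise_cov w t1.+1 t2) in
                  let* M := cstep w th t2 in
                  cmulmx X M^T in
  cret (Tables (store (tab1 T) t1.+1 t2.+1 X1)
               (store (tab2 T) t1.+1 t2.+1 X2)
               (store (tab3 T) t1.+1 t2.+1 X3)).

Definition recursive_variance (R : realType) (n m H : nat) (K : model R n m)
    (w : params R n m) (th : policy R n m) : counted R :=
  let* T := cfold (recursive_step w th) (time_pairs H)
              (Tables (fun _ _ => 0) (fun _ _ => 0) (fun _ _ => 0)) in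
  csum (time_pairs H) (fun t =>
    let t1 := t.1.+1 in let t2 := t.2.+1 in
    let* S := ccov (tab1 T t1 t2) (tab2 T t1 t2) (tab3 T t1 t2)
                   (noise_cov w t1 t2) in
    cquad K th t1 t2 S).

(* R_{i,t} = M_t ... M_i for i <= t *)
Definition ctransition (R : realType) (n m : nat) (w : params R n m)
    (th : policy R n m) (i t : nat) : counted 'M[R]_n :=
  let* M0 := cstep w th i in
  cfold (fun acc j => let* M := cstep w th j in cmulmx M acc)
    (iota i.+1 (t - i)) M0.

Definition brute_force_variance (R : realType) (n m H : nat) (K : model R n m)
    (w : params R n m) (th : policy R n m) : counted R :=
  csum (time_pairs H) (fun t =>
    let t1 := t.1 in let t2 := t.2 in
    let* A1 := csummx [seq (i, j) | i <- iota 1 t1, j <- iota 1 t2] (fun ij =>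
                 let* Ri := ctransition w th ij.1 t1 in
                 let* Rj := ctransition w th ij.2 t2 in
                 let* X := cmulmx Ri (noise_cov w ij.1 ij.2) in
                 cmulmx X Rj^T) in
    let* A2 := csummx (iota 1 t1) (fun i =>
                 let* Ri := ctransition w th i t1 in
                 cmulmx Ri (noise_cov w i t2.+1)) in
    let* A3 := csummx (iota 1 t2) (fun i =>
                 let* Ri := ctransition w th i t2 in
                 cmulmx (noise_cov w t1.+1 i) Ri^T) in
    let* S := ccov A1 A2 A3 (noise_cov w t1.+1 t2.+1) in
    cquad K th t1.+1 t2.+1 S).

(** * The estimation algorithm *)

(* [var w th] is the procedure used for each evaluation of the value function.
   For each (q, d) it is run on every initial segment of the permutation, the
   k-th one being made of its first k elements. *)
Definition shapley_algorithm (R : realType) (n m H Q D : nat)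
    (var : params R n m -> policy R n m -> counted R) (th : policy R n m)
    (w : 'I_Q -> params R n m) (pi : 'I_Q -> 'I_D -> seq (inputs H n m)) :
    counted {ffun inputs H n m -> R} :=
  let* total := cfold (fun (acc : {ffun inputs H n m -> R}) (qd : 'I_Q * 'I_D) =>
      let p := pi qd.1 qd.2 in
      let* v := ctable (fun k : 'I_(#|inputs H n m|.+1) =>
                  var (w qd.1) (restrict th [set x in take k p])) in
      ctable (fun o => let* x := csub (v (inord (index o p).+1))
                                      (v (inord (index o p))) in
                       cadd (acc o) x))
    (enum {: 'I_Q * 'I_D}) [ffun=> 0] in
  let* N := cmul Q%:R D%:R in
  ctable (fun o => cdiv (total o) N).

(* Main.v *)
Require Import Defs.
From mathcomp Require Import all_boot all_order all_algebra.
From mathcomp Require Import all_classical all_reals all_analysis.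
From mathcomp Require Import measurable_realfun zify ring.

Set Implicit Arguments.
Unset Strict Implicit.
Unset Printing Implicit Defensive.

Import Order.TTheory GRing.Theory Num.Theory.
Local Open Scope ring_scope.

(* Unrolling the state recursion, the cumulative reward is a constant plus a
   linear combination of the noise coordinates, with coefficients built from the
   products M_{t-1} ... M_i.  Bilinearity of the covariance then gives the double
   sum of the context, and splitting off the summand i = t1 + 1 or j = t2 + 1
   (where the product is empty) gives A^1 + A^2 + A^3 + Cov(e_{t1+1}, e_{t2+1}).
   As for the cost, put N = n^3 + n^2 m, the order of one evaluation of M_t plus
   one product of n x n matrices.  The recursion spends O(N) on each of the H^2
   pairs of times; brute force spends O(N H) on each of the O(H^2) summands of
   each pair.  There are H n m + 1 evaluations per permutation, and
   n m N = n^4 m + n^3 m^2. *)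

(** * Variance of a linear combination of random variables *)

Section second_moments.
Context d (T : measurableType d) (R : realType) (P : probability T R).

(* [covariance P X X] is the integral of the nonnegative function (X - c)^2 for
   c = [fine 'E_P[X]], whether or not X has a mean: if it is finite, X - c is
   square integrable. *)
Lemma covariance_fin_Lfun2 (X : T -> R) (v : R) :
  measurable_fun setT X -> covariance P X X = v%:E -> X \in Lfun P 2%:E.
Proof.
move=> mX; rewrite unlock unlock; set c := fine _ => XXv.
have mY : measurable_fun setT (X \- cst c) by exact: measurable_funB.
rewrite (_ : X = (X \- cst c) \+ cst c); last first.
  by apply/funext => x /=; rewrite subrK.
apply: rpredD => [|?|?]; [by rewrite lee1n| |exact: Lfun_cst].
rewrite inE; apply/andP; split; first by rewrite inE.
rewrite inE /= /finite_norm unlock /Lnorm poweR_lty//.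
rewrite (eq_integral (EFin \o (X \- cst c) * (X \- cst c))) ?XXv ?ltry// => x _.
by rewrite /= powR_mulrn// real_normK ?num_real// expr2.
Qed.

Lemma Lfun2_lincomb (I : Type) (s : seq I) (a : I -> R) (X : I -> T -> R) :
  (forall i, X i \in Lfun P 2%:E) ->
  (fun x => \sum_(i <- s) a i * X i x) \in Lfun P 2%:E.
Proof.
move=> X2; elim: s => [|i s IHs].
  rewrite (_ : (fun x => _) = cst 0) ?Lfun_cst//.
  by apply/funext => x; rewrite big_nil.
rewrite (_ : (fun x => _) =
    (a i \o* X i) \+ (fun x => \sum_(j <- s) a j * X j x)).
  apply: rpredD => [|?|?//]; first by rewrite lee1n.
  by apply: Lfun_scale; rewrite ?ler1n.
by apply/funext => x; rewrite big_cons /= mulrC.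
Qed.

Lemma covariance_lincombl (I : Type) (s : seq I) (a : I -> R) (X : I -> T -> R)
    (Y : T -> R) :
  (forall i, X i \in Lfun P 2%:E) -> Y \in Lfun P 2%:E ->
  covariance P (fun x => \sum_(i <- s) a i * X i x) Y =
  (\sum_(i <- s) (a i)%:E * covariance P (X i) Y)%E.
Proof.
move=> X2 Y2; elim: s => [|i s IHs].
  rewrite big_nil (_ : (fun x => _) = cst 0) ?covariance_cst_l//.
  by apply/funext => x; rewrite big_nil.
rewrite big_cons -IHs (_ : (fun x => _) =
    (a i \o* X i) \+ (fun x => \sum_(j <- s) a j * X j x)); last first.
  by apply/funext => x; rewrite big_cons /= mulrC.
have P1 : (P setT \is a fin_num) by exact: fin_num_measure.
rewrite covarianceDl ?Lfun2_lincomb//; last first.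
  by apply: Lfun_scale; rewrite ?ler1n.
by rewrite covarianceZl//; [exact: Lfun_subset12..|exact: Lfun2_mul_Lfun1].
Qed.

(** The finite diagonal covariances put each [X i] in L^2, so that bilinearity of the covariance
    applies. *)
Lemma variance_lincomb (I : finType) (c : R) (a : I -> R) (X : I -> T -> R)
    (S : I -> I -> R) :
  (forall i, measurable_fun setT (X i)) ->
  (forall i j, covariance P (X i) (X j) = (S i j)%:E) ->
  variance P (fun x => c + \sum_i a i * X i x) =
  (\sum_i \sum_j a i * S i j * a j)%:E.
Proof.
move=> mX SE.
have X2 i : X i \in Lfun P 2%:E by exact: covariance_fin_Lfun2 (SE i i).
have L2 := Lfun2_lincomb (index_enum I) a X2.
rewrite (varianceD_cst_l c L2) /variance covariance_lincombl//.
rewrite -sumEFin; apply: eq_bigr => i _.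
rewrite covarianceC covariance_lincombl//.
under eq_bigr do rewrite SE -EFinM.
rewrite sumEFin -EFinM; congr _%:E; rewrite mulr_sumr.
apply: eq_bigr => j _.
(* Expanding the second argument went through [covarianceC] and produced [S j i]; [S] inherits the
   symmetry of the covariance. *)
have -> : S j i = S i j by apply: EFin_inj; rewrite -!SE covarianceC.
by rewrite mulrA mulrAC.
Qed.

End second_moments.

(** * Rules for the value and cost of counted computations *)

Lemma foldl_addr (V : zmodType) (I : Type) (F : I -> V) (s : seq I) (x : V) :
  foldl (fun y i => y + F i) x s = x + \sum_(i <- s) F i.
Proof.
elim: s x => [|i s IHs] x /=; first by rewrite big_nil addr0.
by rewrite big_cons addrA IHs.
Qed.

Section counting.
Local Open Scope nat_scope.

(** Value and cost are kept together because [cbind] charges the continuation at the actual result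
    of the first computation. *)
Definition computes (A : Type) (c : counted A) (B : nat) (v : A) : Prop :=
  result c = v /\ ops c <= B.

Lemma computes_le (A : Type) (c : counted A) (B B' : nat) (v : A) :
  computes c B v -> B <= B' -> computes c B' v.
Proof. by case=> rc oc BB'; split=> //; exact: leq_trans BB'. Qed.

Lemma computes_ret (A : Type) (x : A) (B : nat) : computes (cret x) B x.
Proof. by []. Qed.

Lemma computes_bind (A A' : Type) (c : counted A) (f : A -> counted A')
    (B B' : nat) (x : A) (y : A') :
  computes c B x -> computes (f x) B' y -> computes (cbind c f) (B + B') y.
Proof. by case=> <- oc [<- ofx]; split=> //; exact: leq_add. Qed.

Lemma computes_if (A : Type) (b : bool) (c c' : counted A) (B : nat) (x y : A) :
  computes c B x -> computes c' B y ->
  computes (if b then c else c') B (if b then x else y).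
Proof. by case: b. Qed.

Lemma computes_fold (A : Type) (I : eqType) (f : A -> I -> counted A)
    (g : A -> I -> A) (B : nat) (s : seq I) (x : A) :
  (forall y i, i \in s -> computes (f y i) B (g y i)) ->
  computes (cfold f s x) (size s * B) (foldl g x s).
Proof.
(* [cfold] threads a counted accumulator, so the induction needs an arbitrary one in place of
   [cret x]. *)
move=> fg; rewrite -[size s * B]/(ops (cret x) + size s * B).
rewrite -[X in computes _ _ (foldl g X s)]/(result (cret x)) /cfold.
elim: s (cret x) fg => [|i s IHs] c fg; first by split; rewrite //= addn0.
have [fi oi] := fg (result c) i (mem_head i s).
have {IHs} [|rs os] := IHs (cbind c (fun y => f y i)).
  by move=> y j js; apply: fg; rewrite inE js orbT.
split; first by rewrite /= rs /= fi.
rewrite (leq_trans os)//= mulSn addnA leq_add2r leq_add2l.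
exact: oi.
Qed.

Lemma computes_table (A : Type) (I : finType) (F : I -> counted A) (G : I -> A)
    (B : nat) :
  (forall i, computes (F i) B (G i)) ->
  computes (ctable F) (#|I| * B) [ffun i => G i].
Proof.
move=> FG; split=> /=; first by apply/ffunP => i; rewrite !ffunE (FG i).1.
by rewrite -sum_nat_const leq_sum// => i _; exact: (FG i).2.
Qed.

Context (R : realType).

(** The successor of [B] pays for adding each term to the accumulator. *)
Lemma computes_sum (I : eqType) (s : seq I) (F : I -> counted R) (G : I -> R)
    (B : nat) :
  (forall i, i \in s -> computes (F i) B (G i)) ->
  computes (csum s F) (size s * B.+1) (\sum_(i <- s) G i)%R.
Proof.
move=> FG; rewrite -[X in computes _ _ X]add0r -foldl_addr.
apply: computes_fold => x i /FG FGi; rewrite -addn1.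
exact: computes_bind FGi _.
Qed.

Lemma computes_matrix (p q : nat) (F : 'I_p -> 'I_q -> counted R)
    (M : 'M[R]_(p, q)) (B : nat) :
  (forall i j, computes (F i j) B (M i j)) ->
  computes (cmatrix F) (p * q * B) M.
Proof.
move=> FM; split=> /=; first by apply/matrixP => i j; rewrite mxE (FM i j).1.
rewrite -mulnA -[p in p * _]card_ord -sum_nat_const leq_sum// => i _.
rewrite -[q in q * _]card_ord -sum_nat_const leq_sum// => j _.
exact: (FM i j).2.
Qed.

Lemma computes_addmx (p q : nat) (A B : 'M[R]_(p, q)) :
  computes (caddmx A B) (p * q) (A + B)%R.
Proof.
by rewrite -[p * q]muln1; apply: computes_matrix => i j; rewrite mxE.
Qed.

(** Each entry takes q multiplications and q additions, the first one to 0. *)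
Lemma computes_mulmx (p q r : nat) (A : 'M[R]_(p, q)) (B : 'M[R]_(q, r)) :
  computes (cmulmx A B) (p * r * (q * 2)) (A *m B)%R.
Proof.
apply: computes_matrix => i k; rewrite mxE -[q in q * 2]size_enum_ord.
by rewrite -big_enum; apply: computes_sum.
Qed.

Lemma computes_summx (p q : nat) (I : eqType) (s : seq I)
    (F : I -> counted 'M[R]_(p, q)) (G : I -> 'M[R]_(p, q)) (B : nat) :
  (forall i, i \in s -> computes (F i) B (G i)) ->
  computes (csummx s F) (size s * (B + p * q)) (\sum_(i <- s) G i)%R.
Proof.
move=> FG; rewrite -[X in computes _ _ X]add0r -foldl_addr.
apply: computes_fold => x i /FG FGi.
exact: computes_bind FGi (computes_addmx _ _).
Qed.

End counting.

(** * The cumulative reward as an affine function of the noise, and its variance *)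

Section linear_model.
Context (R : realType) (n m : nat) (K : model R n m) (w : params R n m)
  (th : policy R n m).

Definition step (t : nat) : 'M[R]_n :=
  (beta_s w t)^T + (beta_a w t)^T *m (th t)^T.

Definition alpha (t : nat) : 'rV[R]_n :=
  (rew_a K t)^T *m (th t)^T + (rew_s K t)^T.

(* The coefficient of e_i in s_t: R_{i,t-1} for 1 <= i < t, the identity for
   i = t >= 1, and zero for i > t. *)
Fixpoint gain (i t : nat) : 'M[R]_n :=
  if t is t'.+1 then if i == t then 1%:M else step t' *m gain i t' else 0.

Lemma gain_diag t : gain t.+1 t.+1 = 1%:M.
Proof. by rewrite /= eqxx. Qed.

Lemma gainS i t : (i <= t)%N -> gain i t.+1 = step t *m gain i t.
Proof. by move=> it; rewrite /= ltn_eqF. Qed.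

Lemma gain_gt i t : (t < i)%N -> gain i t = 0.
Proof.
elim: t => [//|t IHt] ti /=; rewrite gtn_eqF// IHt ?mulmx0//.
exact: ltnW.
Qed.

Arguments gain : simpl never.

(** The loop of [ctransition] yields R_{i,t}, which is [gain i t.+1]. The induction is on the number
    t - i of factors added on the left of M_i. *)
Lemma gain_transition i t : (0 < i <= t)%N ->
  foldl (fun M j => step j *m M) (step i) (iota i.+1 (t - i)) = gain i t.+1.
Proof.
case: i => [//|i] /andP[_ it]; rewrite -(subnKC it).
move: (t - i.+1)%N => k {it}.
rewrite addKn; elim: k => [|k IHk].
  by rewrite addn0 gainS// gain_diag mulmx1.
rewrite -[X in iota _ X]addn1 iotaD foldl_cat IHk /= addSn.
by rewrite addnS [in RHS]gainS ?addSn ?ltnS ?leqW ?leq_addr.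
Qed.

(** Splits the noise times into those before t + 1, the time t + 1 itself, where the gain is the
    identity, and the later ones, where the gain is zero. *)
Lemma sum_gain (V : zmodType) (F : nat -> 'M[R]_n -> V) (H t : nat) :
  (forall i, F i 0 = 0) -> (t < H)%N ->
  \sum_(k < H) F k.+1 (gain k.+1 t.+1) =
  \sum_(1 <= i < t.+1) F i (gain i t.+1) + F t.+1 1%:M.
Proof.
move=> F0 tH; rewrite -(big_mkord xpredT (fun k => F k.+1 (gain k.+1 t.+1))).
rewrite (@big_cat_nat _ _ _ t.+1)//= -[X in _ = _ + F _ X](gain_diag t).
rewrite -(@big_nat_recr _ _ _ t.+1 1 (fun i => F i (gain i t.+1)))//.
rewrite [RHS]big_add1 /= [X in _ + X = _]big_nat_cond
  [X in _ + X = _]big1 ?addr0//.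
by move=> k /andP[/andP[tk _] _]; rewrite gain_gt.
Qed.

Lemma stateS (e : nat -> 'cV[R]_n) t :
  state K w th e t.+2 =
  mu_s K t.+2 + step t.+1 *m (state K w th e t.+1 - mu_s K t.+1) + e t.+2.
Proof.
transitivity (mu_s K t.+2
  + (beta_s w t.+1)^T *m (state K w th e t.+1 - mu_s K t.+1)
  + (beta_a w t.+1)^T *m
      (action K th t.+1 (state K w th e t.+1) - mu_a K t.+1) + e t.+2).
  by [].
rewrite /action [mu_a _ _ + _]addrC addrK mulmxA.
by rewrite -(addrA (mu_s K t.+2)) -mulmxDl.
Qed.

(** Subtracting the noise-free trajectory cancels the constants of the affine recursion. *)
Lemma state_linear (e : nat -> 'cV[R]_n) t :
  state K w th e t =
  state K w th (fun=> 0) t + \sum_(1 <= i < t.+1) gain i t *m e i.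
Proof.
elim: t => [|t IHt]; first by rewrite big_geq// addr0.
rewrite big_nat_recr// gain_diag mul1mx.
(* Time 1 is apart: s_1 = s_0 + e_1 involves no transition matrix. *)
case: t IHt => [|t] IHt; first by rewrite big_geq//= addr0 add0r.
rewrite !stateS addr0 [RHS]addrA IHt; congr (_ + _).
rewrite (addrAC _ _ (- mu_s K t.+1)) mulmxDr addrA; congr (_ + _).
rewrite mulmx_sumr; apply: eq_big_nat => i /andP[_ it].
by rewrite [in RHS]gainS ?mulmxA.
Qed.

Lemma reward_linear (e : nat -> 'cV[R]_n) t :
  reward K w th e t = reward K w th (fun=> 0) t +
  (alpha t *m \sum_(1 <= i < t.+1) gain i t *m e i) 0 0.
Proof.
rewrite /reward (state_linear e) /action; set s := state _ _ _ _ _.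
set d := \sum_(_ <= _ < _) _.
have add00 (A B : 'M[R]_1) : (A + B) 0 0 = A 0 0 + B 0 0 by rewrite mxE.
rewrite (addrAC s) /alpha !mulmxDr !mulmxDl !mulmxA !add00; ring.
Qed.

(** The coefficient of e_k in the cumulative reward; the terms with t + 1 < k vanish by
    [gain_gt]. *)
Definition noise_coef (H k : nat) : 'rV[R]_n :=
  \sum_(t < H) alpha t.+1 *m gain k t.+1.

Lemma cumulative_reward_linear (H : nat) (e : nat -> 'cV[R]_n) :
  cumulative_reward H K w th e =
  cumulative_reward H K w th (fun=> 0) +
  \sum_(k < H) (noise_coef H k.+1 *m e k.+1) 0 0.
Proof.
rewrite /cumulative_reward !big_mkord.
under eq_bigr do rewrite reward_linear.
rewrite big_split /=; congr (_ + _).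
under [RHS]eq_bigr do rewrite mulmx_suml summxE.
rewrite exchange_big /=; apply: eq_bigr => t _.
rewrite big_nat_recr// gain_diag.
(* Used from right to left, [sum_gain] extends the noise times from 1, ..., t + 1 to 1, ..., H. *)
have /= <- := @sum_gain _ (fun i M => M *m e i) H t
  (fun i => mul0mx _ (e i)) (ltn_ord t).
by rewrite mulmx_sumr summxE; apply: eq_bigr => k _; rewrite mulmxA.
Qed.

(** Since [gain i t1.+1] is R_{i,t1}, this is A^1 at index (t1 + 1, t2 + 1); likewise for A^2 and
    A^3 below. *)
Definition cov_part1 (t1 t2 : nat) : 'M[R]_n :=
  \sum_(1 <= i < t1.+1) \sum_(1 <= j < t2.+1)
    gain i t1.+1 *m noise_cov w i j *m (gain j t2.+1)^T.

Definition cov_part2 (t1 t2 : nat) : 'M[R]_n :=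
  \sum_(1 <= i < t1.+1) gain i t1.+1 *m noise_cov w i t2.+1.

Definition cov_part3 (t1 t2 : nat) : 'M[R]_n :=
  \sum_(1 <= j < t2.+1) noise_cov w t1.+1 j *m (gain j t2.+1)^T.

Definition state_cov (t1 t2 : nat) : 'M[R]_n :=
  cov_part1 t1 t2 + cov_part2 t1 t2 + cov_part3 t1 t2
  + noise_cov w t1.+1 t2.+1.

Definition reward_var (H : nat) : R :=
  \sum_(t <- time_pairs H)
    (alpha t.1.+1 *m state_cov t.1 t.2 *m (alpha t.2.+1)^T) 0 0.

(** The summands with j <= t2 have M_{t2+1} as left factor of R_{j,t2+1}. For j = t2 + 1 this
    product is M_{t2+1} alone, which gives the A^2 term. *)
Lemma cov_part1_rec t1 t2 : cov_part1 t1 t2.+1 =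
  (cov_part1 t1 t2 + cov_part2 t1 t2) *m (step t2.+1)^T.
Proof.
rewrite /cov_part1 /cov_part2 -big_split mulmx_suml.
apply: eq_bigr => i _ /=; rewrite big_nat_recr//= mulmxDl mulmx_suml.
congr (_ + _); last by rewrite (@gainS t2.+1)// gain_diag mulmx1.
apply: eq_big_nat => j /andP[_ jt].
by rewrite (@gainS j t2.+1) ?trmx_mul ?mulmxA// ltnW.
Qed.

Lemma cov_part2_rec t1 t2 : cov_part2 t1.+1 t2 =
  step t1.+1 *m (cov_part2 t1 t2 + noise_cov w t1.+1 t2.+1).
Proof.
rewrite /cov_part2 big_nat_recr// mulmxDr mulmx_sumr.
congr (_ + _); last by rewrite gainS// gain_diag mulmx1.
by apply: eq_big_nat => i /andP[_ it]; rewrite (@gainS i t1.+1) ?mulmxA// ltnW.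
Qed.

Lemma cov_part3_rec t1 t2 : cov_part3 t1 t2.+1 =
  (cov_part3 t1 t2 + noise_cov w t1.+1 t2.+1) *m (step t2.+1)^T.
Proof.
rewrite /cov_part3 big_nat_recr// mulmxDl mulmx_suml.
congr (_ + _); last by rewrite gainS// gain_diag mulmx1.
apply: eq_big_nat => j /andP[_ jt].
by rewrite (@gainS j t2.+1) ?trmx_mul ?mulmxA// ltnW.
Qed.

(** [sum_gain] in l and then in k leaves past and current times on each side; the four combinations
    are the summands of [state_cov]. *)
Lemma state_covE (H t1 t2 : nat) : (t1 < H)%N -> (t2 < H)%N ->
  \sum_(k < H) \sum_(l < H)
    gain k.+1 t1.+1 *m noise_cov w k.+1 l.+1 *m (gain l.+1 t2.+1)^T =
  state_cov t1 t2.
Proof.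
move=> t1H t2H.
under eq_bigr => k _.
  have /= -> := @sum_gain _
    (fun j M => gain k.+1 t1.+1 *m noise_cov w k.+1 j *m M^T) H t2 _ t2H.
    over.
  by move=> i; rewrite trmx0 mulmx0.
have /= -> // := @sum_gain _ (fun i M => \sum_(1 <= j < t2.+1)
  M *m noise_cov w i j *m (gain j t2.+1)^T + M *m noise_cov w i t2.+1 *m 1%:M^T)
  H t1 _ t1H; last first.
  by move=> i; rewrite !mul0mx addr0 big1// => j _; rewrite !mul0mx.
rewrite /state_cov /cov_part1 /cov_part2 /cov_part3 big_split /=.
rewrite trmx1 !mulmx1 !mul1mx addrA; congr (_ + _ + _ + _).
- by apply: eq_bigr => i _; rewrite mulmx1.
- by apply: eq_bigr => i _; rewrite mul1mx.
Qed.

(** Both sides are the same fourfold sum over two reward times and two noise times, taken in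
    different orders. *)
Lemma reward_varE (H : nat) : reward_var H =
  \sum_(k < H) \sum_(l < H)
    (noise_coef H k.+1 *m noise_cov w k.+1 l.+1 *m (noise_coef H l.+1)^T) 0 0.
Proof.
rewrite /reward_var /time_pairs big_allpairs.
rewrite -[H in iota 0 H]subn0 -/(index_iota 0 H) big_mkord.
under eq_bigr do rewrite big_mkord.
under eq_bigr => t1 _.
  under eq_bigr => t2 _.
    rewrite -(state_covE (ltn_ord t1) (ltn_ord t2)).
    rewrite mulmx_sumr mulmx_suml summxE.
    under eq_bigr do rewrite mulmx_sumr mulmx_suml summxE.
    over.
  over.
rewrite /= /noise_coef.
under [RHS]eq_bigr => k _.
  under eq_bigr => l _.
    rewrite raddf_sum mulmx_sumr summxE.
    under eq_bigr do rewrite !mulmx_suml summxE.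
    over.
  over.
rewrite /=.
under eq_bigr do rewrite exchange_big /=.
rewrite exchange_big /=; apply: eq_bigr => k _.
under eq_bigr do rewrite exchange_big /=.
rewrite exchange_big /=; apply: eq_bigr => l _.
rewrite exchange_big /=; apply: eq_bigr => t2 _; apply: eq_bigr => t1 _.
by rewrite trmx_mul !mulmxA.
Qed.

Lemma variance_cumulative_reward (d : measure_display) (T : measurableType d)
    (H : nat) (P : probability T R) (e : nat -> 'I_n -> T -> R) :
  noise_model H P e w ->
  variance P (fun x => cumulative_reward H K w th (fun t => \col_i e t i x)) =
  (reward_var H)%:E.
Proof.
case=> gauss_e cov_e.
pose X (ki : 'I_H * 'I_n) := e ki.1.+1 ki.2.
pose S (ki lj : 'I_H * 'I_n) := noise_cov w ki.1.+1 lj.1.+1 ki.2 lj.2.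
pose a (ki : 'I_H * 'I_n) := noise_coef H ki.1.+1 0 ki.2.
(* The linear combination with indicator coefficients is the coordinate itself, so [gauss_e] makes
   it measurable. *)
have mX ki : measurable_fun setT (X ki).
  have [+ _] := gauss_e (fun lj => (lj == ki)%:R).
  congr (measurable_fun _ _); apply/funext => x; rewrite (bigD1 ki)//=.
  by rewrite eqxx mul1r big1 ?addr0// => lj /negPf ->; rewrite mul0r.
have covX ki lj : covariance P (X ki) (X lj) = (S ki lj)%:E by exact: cov_e.
rewrite (_ : (fun x => _) = (fun x =>
    cumulative_reward H K w th (fun=> 0) + \sum_ki a ki * X ki x)); last first.
  apply/funext => x; rewrite cumulative_reward_linear; congr (_ + _).
  rewrite -(pair_bigA _ (fun k i => a (k, i) * X (k, i) x)) /=.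
  by apply: eq_bigr => k _; rewrite mxE; apply: eq_bigr => i _; rewrite mxE.
rewrite (variance_lincomb _ a mX covX) reward_varE; congr _%:E.
rewrite -(pair_bigA _ (fun k i => \sum_lj a (k, i) * S (k, i) lj * a lj)) /=.
apply: eq_bigr => k _.
under eq_bigr => i _ do rewrite
  -(pair_bigA _ (fun l j => a (k, i) * S (k, i) (l, j) * a (l, j))) /=.
rewrite exchange_big /=; apply: eq_bigr => l _.
rewrite mxE exchange_big /=; apply: eq_bigr => j _.
by rewrite !mxE mulr_suml.
Qed.

End linear_model.

(** * Correctness and cost of the two variance procedures *)

Definition base_cost (n m : nat) : nat := (n ^ 3 + n ^ 2 * m)%N.

Section variance_algorithms.
Context (R : realType) (n m : nat) (K : model R n m) (w : params R n m)
  (th : policy R n m).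
Context (n_gt0 : (0 < n)%N) (m_gt0 : (0 < m)%N).

Local Notation N := (base_cost n m).

(** For positive dimensions every elementary matrix cost is absorbed by [N], so the bounds below
    become arithmetic on multiples of [N]. *)
Lemma base_cost_ge : [/\ n * n * n <= N, n * n * m <= N, n * n <= N,
  n * m <= N & n <= N]%N /\ (0 < N)%N.
Proof.
rewrite /base_cost !expnS expn0 !muln1.
have nm : (n <= n * m)%N by rewrite leq_pmulr.
have nnm : (n * m <= n * n * m)%N by rewrite -mulnA leq_pmull.
have nn : (n * n <= n * n * n)%N by rewrite leq_pmulr.
by split; [split|]; lia.
Qed.

(** Follows the syntax of a program, building its exact cost bound in an existential variable that
    [computes_le] then compares with the stated one. *)
Local Ltac count_ops :=
  lazymatch goal with
  | |- computes (cbind _ _) _ _ =>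
      eapply computes_bind; [count_ops | cbv beta; count_ops]
  | |- computes (cret _) _ _ => exact: (computes_ret _ 0)
  | |- computes (caddmx _ _) _ _ => exact: computes_addmx
  | |- computes (cmulmx _ _) _ _ => exact: computes_mulmx
  | _ => solve [eauto with cost]
  end.

Lemma computes_step t : computes (cstep w th t) (3 * N) (step w th t).
Proof.
have [[? ? ? ? ?] ?] := base_cost_ge.
rewrite /cstep; eapply computes_le; [count_ops | lia].
Qed.

#[local] Hint Resolve computes_step : cost.

Lemma computes_alpha t : computes (calpha K th t) (3 * N) (alpha K th t).
Proof.
have [[? ? ? ? ?] ?] := base_cost_ge.
rewrite /calpha; eapply computes_le; [count_ops | lia].
Qed.

#[local] Hint Resolve computes_alpha : cost.

Lemma computes_quad t1 t2 (S : 'M[R]_n) :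
  computes (cquad K th t1 t2 S) (10 * N)
    ((alpha K th t1 *m S *m (alpha K th t2)^T) 0 0).
Proof.
have [[? ? ? ? ?] ?] := base_cost_ge.
(* 3N for each [alpha] and at most 2N for each of the two products. *)
rewrite /cquad; eapply computes_le; [count_ops | lia].
Qed.

#[local] Hint Resolve computes_quad : cost.

Lemma computes_cov (A1 A2 A3 S : 'M[R]_n) :
  computes (ccov A1 A2 A3 S) (3 * N) (A1 + A2 + A3 + S).
Proof.
have [[? ? ? ? ?] ?] := base_cost_ge.
rewrite /ccov; eapply computes_le; [count_ops | lia].
Qed.

#[local] Hint Resolve computes_cov : cost.

Lemma mem_time_pairs (H : nat) (t : nat * nat) :
  (t \in time_pairs H) = (t.1 < H)%N && (t.2 < H)%N.
Proof.
apply/allpairsP/andP => [[s [+ + ->]]|[t1 t2]]; first by rewrite !mem_iota.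
by exists t; rewrite !mem_iota; case: t t1 t2.
Qed.

Lemma size_time_pairs (H : nat) : size (time_pairs H) = (H ^ 2)%N.
Proof. by rewrite size_allpairs size_iota. Qed.

(** The uncounted counterpart of [recursive_step]: the content of the tables is then a statement
    about a plain [foldl]. *)
Definition table_step (T : tables R n) (t : nat * nat) : tables R n :=
  let t1 := t.1 in let t2 := t.2 in
  Tables
    (store (tab1 T) t1.+1 t2.+1
       (if (t1 == 0%N) || (t2 == 0%N) then 0
        else (tab1 T t1.+1 t2 + tab2 T t1.+1 t2) *m (step w th t2)^T))
    (store (tab2 T) t1.+1 t2.+1
       (if t1 == 0%N then 0
        else step w th t1 *m (tab2 T t1 t2.+1 + noise_cov w t1 t2.+1)))
    (store (tab3 T) t1.+1 t2.+1
       (if t2 == 0%N then 0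
        else (tab3 T t1.+1 t2 + noise_cov w t1.+1 t2) *m (step w th t2)^T)).

Lemma computes_recursive_step (T : tables R n) (t : nat * nat) :
  computes (recursive_step w th T t) (18 * N) (table_step T t).
Proof.
have [[? ? ? ? ?] ?] := base_cost_ge.
have addmx_mulmx (A B M : 'M[R]_n) (c : counted 'M[R]_n) :
    computes c (3 * N) M ->
    computes (let* X := caddmx A B in let* M := c in cmulmx X M^T) (6 * N)
      ((A + B) *m M^T).
  by move=> cM; eapply computes_le; [count_ops | lia].
(* For each of the three entries: N for the sum, 3N for the transition matrix, 2N for the
   product. *)
rewrite (_ : 18 * N = 6 * N + (6 * N + (6 * N + 0)))%N; last by lia.
apply: computes_bind.
  apply: computes_if; first exact: computes_ret.
  by apply: addmx_mulmx; exact: computes_step.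
apply: computes_bind.
  apply: computes_if; first exact: computes_ret.
  by eapply computes_le; [count_ops | lia].
apply: computes_bind.
  apply: computes_if; first exact: computes_ret.
  by apply: addmx_mulmx; exact: computes_step.
exact: computes_ret.
Qed.

Definition filled (T : tables R n) (t1 t2 : nat) : Prop :=
  [/\ tab1 T t1.+1 t2.+1 = cov_part1 w th t1 t2,
      tab2 T t1.+1 t2.+1 = cov_part2 w th t1 t2 &
      tab3 T t1.+1 t2.+1 = cov_part3 w th t1 t2].

Lemma table_step_filled (T : tables R n) (t1 t2 : nat) :
  (forall s, t2 = s.+1 -> filled T t1 s) ->
  (forall s, t1 = s.+1 -> filled T s t2) ->
  filled (table_step T (t1, t2)) t1 t2.
Proof.
move=> left up; split; rewrite /table_step /store /= !eqxx /=.
- case: t1 left up => [|s1] left up /=; first by rewrite /cov_part1 big_geq.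
  case: t2 left up => [|s2] left up /=.
    by rewrite /cov_part1 big1// => i _; rewrite big_geq.
  by have [-> -> _] := left _ erefl; rewrite cov_part1_rec.
- case: t1 left up => [|s1] left up /=; first by rewrite /cov_part2 big_geq.
  by have [_ -> _] := up _ erefl; rewrite cov_part2_rec.
- case: t2 left up => [|s2] left up /=; first by rewrite /cov_part3 big_geq.
  by have [_ _ ->] := left _ erefl; rewrite cov_part3_rec.
Qed.

Lemma table_step_stable (T : tables R n) (t : nat * nat) (i j : nat) :
  (i, j) != t -> filled T i j -> filled (table_step T t) i j.
Proof.
case: t => t1 t2; rewrite xpair_eqE => /negPf ij [T1 T2 T3].
by split; rewrite /table_step /store /= !eqSS ij.
Qed.

(** The pairs are visited row by row, so the left and upper neighbours of an entry are filled before
    it, and later steps write elsewhere. *)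
Lemma filled_time_pairs (H : nat) (T : tables R n) (t1 t2 : nat) :
  (t1 < H)%N -> (t2 < H)%N -> filled (foldl table_step T (time_pairs H)) t1 t2.
Proof.
rewrite /time_pairs => t1H t2H.
(* Invariant inside row k: all earlier rows and the first l entries of this one are filled. *)
have row k (S : tables R n) :
    (forall i j, (i < k)%N -> (j < H)%N -> filled S i j) ->
    forall l, (l <= H)%N ->
    let S' := foldl table_step S [seq (k, j) | j <- iota 0 l] in
    forall i j, (j < H)%N -> (i < k)%N || (i == k) && (j < l)%N ->
    filled S' i j.
  move=> Sk; elim=> [|l IHl] lH S' i j jH; rewrite {}/S'.
    by rewrite ltn0 andbF orbF => ik; exact: Sk.
  rewrite -[l.+1]addn1 iotaD map_cat foldl_cat => ij.
  have {}IHl := IHl (ltnW lH).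
  have [ijE|ij_neq] := eqVneq (i, j) (k, l).
    have [-> ->] : i = k /\ j = l by case: ijE.
    apply: table_step_filled => s sE; apply: IHl; lia.
  apply: (table_step_stable ij_neq); apply: IHl => //.
  by move: ij_neq; rewrite xpair_eqE; lia.
have rows k : (k <= H)%N ->
    let S := foldl table_step T [seq (i, j) | i <- iota 0 k, j <- iota 0 H] in
    forall i j, (i < k)%N -> (j < H)%N -> filled S i j.
  elim: k => [//|k IHk] kH S i j ik jH; rewrite {}/S.
  rewrite -[k.+1]addn1 iotaD allpairs_cat foldl_cat /= cats0.
  by apply: (row k _ (IHk (ltnW kH)) H (leqnn H)); lia.
exact: rows (leqnn H) _ _ t1H t2H.
Qed.

Lemma computes_recursive_variance (H : nat) :
  computes (recursive_variance H K w th) (32 * N * H ^ 2) (reward_var K w th H).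
Proof.
have [[? ? ? ? ?] ?] := base_cost_ge.
rewrite /recursive_variance; eapply computes_le.
  eapply computes_bind.
    by apply: computes_fold => T t _; exact: computes_recursive_step.
  apply: computes_sum => t; rewrite mem_time_pairs => /andP[t1H t2H].
  have [-> -> ->] := filled_time_pairs (Tables (fun _ _ => 0) (fun _ _ => 0)
    (fun _ _ => 0)) t1H t2H.
  by count_ops.
(* Per pair: 18N to fill the tables, 3N + 10N for the summand and 1 to accumulate it, hence 32N. *)
rewrite !size_time_pairs; have : (H ^ 2 <= N * H ^ 2)%N by rewrite leq_pmull.
by move: (H ^ 2)%N => h; nia.
Qed.

Lemma computes_transition (H i t : nat) : (0 < i <= t)%N -> (t < H)%N ->
  computes (ctransition w th i t) (5 * N * H) (gain w th i t.+1).
Proof.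
have [[? ? ? ? ?] ?] := base_cost_ge.
move=> it tH; rewrite -gain_transition//.
rewrite /ctransition; eapply computes_le.
  eapply computes_bind; first exact: computes_step.
  by apply: computes_fold => M j _; count_ops.
rewrite size_iota.
(* 3N for M_i, then 3N + 2N for each further factor, with t - i + 1 <= H. *)
have : (3 * N + (t - i) * (5 * N) <= 5 * N * H)%N by nia.
apply: leq_trans; rewrite leq_add2l leq_mul2l; apply/orP; right; lia.
Qed.

Lemma computes_brute_force_variance (H : nat) :
  computes (brute_force_variance H K w th) (45 * N * H ^ 5)
    (reward_var K w th H).
Proof.
have [[? ? ? ? ?] N_gt0] := base_cost_ge.
(* 44 N H^3 per pair of times and 1 to accumulate; the latter is at most N H^3 once H > 0. *)
apply: (@computes_le _ _ (H ^ 2 * (44 * N * H ^ 3).+1)); last first.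
  case: H => [//|H]; rewrite (expnD _ 2 3) mulnCA leq_mul2l; apply/orP; right.
  have : (0 < H.+1 ^ 3)%N by rewrite expn_gt0.
  nia.
rewrite -size_time_pairs; apply: computes_sum => t.
rewrite mem_time_pairs => /andP[t1H t2H].
have H_gt0 : (0 < H)%N by exact: leq_ltn_trans t1H.
have HH3 : (H * H <= H ^ 3)%N by rewrite !expnS expn0 muln1; nia.
have H3 : (0 < H ^ 3)%N by rewrite expn_gt0 H_gt0.
(* A^1 has at most H^2 summands of cost 10NH + 4N + N (two transitions, two products, one addition).
   A^2 and A^3 have at most H each, of cost 5NH + 2N + N. [ccov] and [cquad] add 3N + 10N. *)
apply: (@computes_le _ _ (15 * N * H ^ 3 + (8 * N * H ^ 3 +
  (8 * N * H ^ 3 + (3 * N + 10 * N))))); last by nia.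
apply: computes_bind.
  instantiate (1 := cov_part1 w th t.1 t.2).
  rewrite /cov_part1 /index_iota !subn1 /=.
  rewrite -(big_allpairs (F := fun ij : nat * nat =>
    gain w th ij.1 t.1.+1 *m noise_cov w ij.1 ij.2 *m
    (gain w th ij.2 t.2.+1)^T)).
  eapply computes_le.
    apply: computes_summx => _ /allpairsP[[i j] /= [+ + ->]] /=.
    rewrite !mem_iota !add1n !ltnS => it jt.
    have := computes_transition it t1H; have := computes_transition jt t2H.
    by move=> cj ci; count_ops.
  rewrite size_allpairs !size_iota.
  have NH : (N <= N * H)%N by rewrite leq_pmulr.
  apply: (@leq_trans (H * H * (15 * N * H))); last by rewrite !expnS expn0; lia.
  by apply: leq_mul; [rewrite leq_mul// ltnW | lia].
apply: computes_bind.
  instantiate (1 := cov_part2 w th t.1 t.2).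
  rewrite /cov_part2 /index_iota !subn1 /=.
  eapply computes_le.
    apply: computes_summx => i; rewrite mem_iota add1n ltnS => it.
    by have ci := computes_transition it t1H; count_ops.
  rewrite size_iota; have NH : (N <= N * H)%N by rewrite leq_pmulr.
  apply: (@leq_trans (H * (8 * N * H))).
    by apply: leq_mul; [exact: ltnW | lia].
  by rewrite mulnCA leq_mul2l HH3 orbT.
apply: computes_bind.
  instantiate (1 := cov_part3 w th t.1 t.2).
  rewrite /cov_part3 /index_iota !subn1 /=.
  eapply computes_le.
    apply: computes_summx => i; rewrite mem_iota add1n ltnS => it.
    by have ci := computes_transition it t2H; count_ops.
  rewrite size_iota; have NH : (N <= N * H)%N by rewrite leq_pmulr.
  apply: (@leq_trans (H * (8 * N * H))).
    by apply: leq_mul; [exact: ltnW | lia].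
  by rewrite mulnCA leq_mul2l HH3 orbT.
by count_ops.
Qed.

End variance_algorithms.

(** * The permutation estimator *)

Lemma set_take_index (O : finType) (p : seq O) (o : O) : o \in p ->
  [set x in take (index o p).+1 p] = o |: preceding p o.
Proof.
move=> op; apply/setP => x.
by rewrite !inE (take_nth o) ?index_mem// nth_index// mem_rcons inE.
Qed.

Section estimator.
Context (R : realType) (n m H Q D : nat)
  (var : params R n m -> policy R n m -> counted R) (th : policy R n m)
  (w : 'I_Q -> params R n m) (pi : 'I_Q -> 'I_D -> seq (inputs H n m))
  (v : 'I_Q -> {set inputs H n m} -> R) (B : nat).
Context (computes_v : forall q U,
    computes (var (w q) (Defs.restrict th U)) B (v q U))
  (perm_pi : forall q d, perm_eq (pi q d) (enum (inputs H n m))).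

Definition increment (q : 'I_Q) (d : 'I_D) (o : inputs H n m) : R :=
  v q (o |: preceding (pi q d) o) - v q (preceding (pi q d) o).

(** Each permutation costs one evaluation per initial segment, then a subtraction and an addition
    per input. The end costs one product Q D and a division per input. *)
Lemma computes_shapley : computes (shapley_algorithm var th w pi)
  (Q * D * ((H * n * m).+1 * B + H * n * m * 2) + (1 + H * n * m * 1))
  [ffun o => (\sum_q \sum_d increment q d o) / (Q%:R * D%:R)].
Proof.
have cardI : #|inputs H n m| = (H * n * m)%N by rewrite !card_prod !card_ord.
pose total s := [ffun o => \sum_(qd <- s) increment qd.1 qd.2 o].
rewrite -cardI; apply: computes_bind.
  instantiate (1 := total (enum {: 'I_Q * 'I_D})).
  have -> : total (enum {: 'I_Q * 'I_D}) =
      foldl (fun (acc : {ffun inputs H n m -> R}) qd =>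
        [ffun o => acc o + increment qd.1 qd.2 o])
      [ffun=> 0] (enum {: 'I_Q * 'I_D}).
    apply/ffunP => o; rewrite ffunE; set s := enum _.
    rewrite -[LHS]add0r -[X in X + _](ffunE (fun=> 0) o).
    elim: s [ffun=> 0] => [|qd s IHs] acc; first by rewrite big_nil addr0.
    by rewrite big_cons /= -IHs ffunE addrA.
  have -> : (Q * D)%N = size (enum {: 'I_Q * 'I_D}).
    by rewrite -cardE card_prod !card_ord.
  apply: computes_fold => acc [q d] _ /=.
  have pi_size : size (pi q d) = #|inputs H n m|.
    by rewrite (perm_size (perm_pi q d)) -cardE.
  apply: computes_bind.
    by rewrite -[X in (X * B)%N]card_ord; apply: computes_table => k;
      exact: computes_v.
  apply: computes_table => o.
  have o_pi : o \in pi q d by rewrite (perm_mem (perm_pi q d)) mem_enum.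
  have o_lt : (index o (pi q d) < #|inputs H n m|)%N.
    by rewrite -pi_size index_mem.
  (* Both [index o p] and its successor are at most the number of inputs, so [inord] does not fall
     back on its default. *)
  by rewrite /increment -set_take_index// !ffunE !inordK ?ltnS// ltnW.
apply: (computes_bind (x := Q%:R * D%:R)); first by split.
apply: computes_table => o; split=> //=.
by rewrite ffunE big_enum /= pair_big.
Qed.

Lemma shapley_hatE (g : 'I_Q -> {set inputs H n m} -> \bar R)
    (o : inputs H n m) :
  (forall q U, g q U = (v q U)%:E) ->
  shapley_hat g pi o = ((\sum_q \sum_d increment q d o) / (Q%:R * D%:R))%:E.
Proof.
move=> gE; rewrite /shapley_hat -natrM mulrC EFinM; congr (_ * _)%E.
rewrite -sumEFin; apply: eq_bigr => q _; rewrite -sumEFin.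
by apply: eq_bigr => d _; rewrite !gE.
Qed.

Lemma shapley_cost_le : (0 < Q * D)%N -> (0 < H * n * m)%N -> (0 < B)%N ->
  (Q * D * ((H * n * m).+1 * B + H * n * m * 2) + (1 + H * n * m * 1)
   <= 6 * (Q * D * (H * n * m * B)))%N.
Proof.
move: (Q * D)%N (H * n * m)%N => q i q_gt0 i_gt0 B_gt0.
have iB : (i <= i * B)%N by rewrite leq_pmulr.
have BiB : (B <= i * B)%N by rewrite leq_pmull.
have : (i * B <= q * (i * B))%N by rewrite leq_pmull.
(* The factor 6 is 4 for this loop, with B and i both at most i B, plus 2 for the final 1 + i
   operations. *)
have : (q * (i.+1 * B + i * 2) <= q * (4 * (i * B)))%N.
  by rewrite leq_mul2l; lia.
lia.
Qed.

End estimator.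

Theorem proposition4 :
  exists C : nat,
  forall (R : realType) (n m H Q D : nat),
    (0 < n)%N -> (0 < m)%N -> (0 < H)%N -> (0 < Q)%N -> (0 < D)%N ->
  forall (K : model R n m) (th : policy R n m) (w : 'I_Q -> params R n m)
    (pi : 'I_Q -> 'I_D -> seq (inputs H n m)),
    (forall q d, perm_eq (pi q d) (enum (inputs H n m))) ->
  forall (disp : measure_display) (T : measurableType disp)
    (P : 'I_Q -> probability T R) (e : 'I_Q -> nat -> 'I_n -> T -> R),
    (forall q, noise_model H (P q) (e q) (w q)) ->
  let Sh := shapley_hat (fun q => value K th (P q) (e q) (w q)) pi in
  let rec_alg := shapley_algorithm (recursive_variance H K) th w pi in
  let brute_alg := shapley_algorithm (brute_force_variance H K) th w pi in
  ((forall o, (result rec_alg o)%:E = Sh o) /\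
   (ops rec_alg <= C * (Q * D * H ^ 3 * (n ^ 4 * m + n ^ 3 * m ^ 2)))%N) /\
  ((forall o, (result brute_alg o)%:E = Sh o) /\
   (ops brute_alg <= C * (Q * D * H ^ 6 * (n ^ 4 * m + n ^ 3 * m ^ 2)))%N).
Proof.
(* 270 = 6 * 45: the factor of [shapley_cost_le] times the larger of the constants 32 and 45. *)
exists 270%N => R n m H Q D n_gt0 m_gt0 H_gt0 Q_gt0 D_gt0 K th w pi perm_pi.
move=> disp T P e noise Sh rec_alg brute_alg.
pose v q (U : {set inputs H n m}) := reward_var K (w q) (Defs.restrict th U) H.
have valueE q U : value K th (P q) (e q) (w q) U = (v q U)%:E.
  exact: variance_cumulative_reward (noise q).
(* Common to both algorithms, with k = 2 and k = 5; the number H n m of inputs raises the exponent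
   of H by one. *)
have correct_and_cheap var c k : (0 < c <= 45)%N ->
    (forall q U, computes (var (w q) (Defs.restrict th U))
      (c * base_cost n m * H ^ k) (v q U)) ->
    let alg := shapley_algorithm var th w pi in
    (forall o, (result alg o)%:E = Sh o) /\
    (ops alg <= 270 * (Q * D * H ^ k.+1 * (n ^ 4 * m + n ^ 3 * m ^ 2)))%N.
  move=> /andP[c_gt0 c_le] computes_v.
  have [algE alg_ops] := computes_shapley computes_v perm_pi.
  split=> [i|]; first by rewrite algE ffunE -(shapley_hatE _ _ valueE).
  have N_gt0 := (base_cost_ge n_gt0 m_gt0).2.
  apply: leq_trans alg_ops _; apply: leq_trans (shapley_cost_le _ _ _) _.
  - by rewrite muln_gt0 Q_gt0.
  - by rewrite !muln_gt0 H_gt0 n_gt0.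
  - by rewrite !muln_gt0 c_gt0 N_gt0 expn_gt0 H_gt0.
  have -> : (n ^ 4 * m + n ^ 3 * m ^ 2 = n * m * base_cost n m)%N.
    by rewrite /base_cost !expnS !expn0; lia.
  rewrite expnS; move: (H ^ k)%N (base_cost n m) => h N.
  rewrite [leqLHS](_ : _ = 6 * c * (Q * D * (H * h) * (n * m * N)))%N.
    by rewrite leq_mul2r; apply/orP; right; lia.
  by lia.
split.
  by apply: (correct_and_cheap _ 32) => // q U; exact: computes_recursive_variance.
by apply: (correct_and_cheap _ 45) => // q U;
  exact: computes_brute_force_variance.
Qed.
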